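(* Let $H = (V,E,w)$ be a finite connected simple weighted graph whose weight function is identically $1$ (i.e. $w(e)=1$ for every $e\in E$), and regard $V$ as a metric space with the shortest path distance of $H$. Then this metric space can be isometrically embedded in a Hilbert space if and only if $H$ is a path or a complete graph.
   Context: For a connected weighted graph $H=(V,E,w)$ with positive edge weights, the shortest path distance $d_H(u,v)$ is the minimum, over all paths from $u$ to $v$ in $H$, of the sum of the weights of the edges of the path. ''$H$ can be isometrically embedded in a Hilbert space'' means there is a real Hilbert space $\mathcal{H}$ and a map $\phi: V\to\mathcal{H}$ with $\|\phi(u)-\phi(v)\|_{\mathcal{H}} = d_H(u,v)$ for all $u,v\in V$. A path is a graph whose vertices can be ordered $v_1,\dots,v_n$ so that $v_i$ and $v_j$ are adjacent if and only if $|i-j|=1$ (a single vertex counts as a path). *)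

(* Defs.v *)
From HB Require Import structures.
From mathcomp Require Import all_boot all_order all_algebra.
From mathcomp Require Import all_classical all_reals all_analysis.

Set Implicit Arguments.
Unset Strict Implicit.
Unset Printing Implicit Defensive.

Import Order.TTheory GRing.Theory Num.Theory.
Import numFieldNormedType.Exports.

Local Open Scope classical_set_scope.
Local Open Scope ring_scope.

(* With [idfun] as conjugation, a [{dot _ for _}] form is a real inner product:
   bilinear, symmetric and positive definite. *)
Record hilbertSpace (R : realType) := HilbertSpace {
  hilbert_carrier :> completeNormedModType R;
  hilbert_dot : {dot hilbert_carrier for (@idfun R)};
  hilbert_normE : forall x : hilbert_carrier,
    `|x| = Num.sqrt (hilbert_dot x x)
}.

(* The values of [weight] on pairs of non-adjacent vertices are irrelevant. *)
Record weightedGraph (R : realType) (V : finType) := WeightedGraph {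
  adj : rel V;
  adj_sym : symmetric adj;
  adj_irr : irreflexive adj;
  weight : V -> V -> R;
  weight_sym : forall u v, adj u v -> weight u v = weight v u;
  weight_gt0 : forall u v, adj u v -> 0 < weight u v
}.

Section Graph.
Variables (R : realType) (V : finType) (H : weightedGraph R V).
Implicit Types (u v : V) (p : seq V).

(* The empty graph counts as connected (and as complete). *)
Definition graph_connected : Prop := forall u v, connect (adj H) u v.

(* [p] lists the vertices of the path other than its starting point [u]. *)
Definition path_from_to u v p : Prop :=
  [/\ path (adj H) u p, uniq (u :: p) & last u p = v].

Definition path_length u p : R := \sum_(l <- pairmap (weight H) u p) l.

(* In a connected graph the infimum is a minimum: see [graph_distP]. *)
Definition graph_dist u v : R :=
  inf [set l | exists2 p, path_from_to u v p & l = path_length u p].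

Lemma graph_distP u v : graph_connected ->
  (exists2 p, path_from_to u v p & path_length u p = graph_dist u v) /\
  (forall p, path_from_to u v p -> graph_dist u v <= path_length u p).
Proof.
move=> conn.
have [p0 p0P] : exists p, path_from_to u v p.
  have /connectP[p pp vE] := conn u v.
  by case/shortenP: pp vE => q qp uq _ vE; exists q.
pose T := {n : 'I_#|V|.+1 & n.-tuple V}.
pose P (t : T) := `[< path_from_to u v (tagged t) >].
have toT p : path_from_to u v p -> exists2 t : T, P t & tagged t = p :> seq V.
  move=> pP; have [_ up _] := pP.
  have szp : (size p < #|V|.+1)%N.
    by rewrite ltnS ltnW // -[_.+1]/(size (u :: p)) -(card_uniqP up) max_card.
  exists (Tagged (fun n : 'I_#|V|.+1 => n.-tuple V)
    (in_tuple p : (Ordinal szp).-tuple V)) => //.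
  exact/asboolP.
have [t0 Pt0 _] := toT _ p0P.
case: (Order.TotalTheory.arg_minP (fun t : T => path_length u (tagged t)) Pt0).
move=> m /asboolP mP min_m.
have m_lb p : path_from_to u v p -> path_length u (tagged m) <= path_length u p.
  by move=> /toT[t Pt <-]; exact: min_m.
have distE : graph_dist u v = path_length u (tagged m).
  apply/le_anti/andP; split.
    apply: ge_inf; last by exists (tagged m).
    by exists (path_length u (tagged m)) => _ [p pP ->]; exact: m_lb.
  apply: lb_le_inf; first by exists (path_length u (tagged m)), (tagged m).
  by move=> _ [p pP ->]; exact: m_lb.
by rewrite distE; split=> //; exists (tagged m).
Qed.

(* Vertices are numbered from 0 rather than from 1. *)
Definition is_path_graph : Prop :=
  exists (n : nat) (v : 'I_n -> V), bijective v /\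
    forall i j : 'I_n, adj H (v i) (v j) <-> `|i%:Z - j%:Z| = 1.

Definition is_complete_graph : Prop := forall u v, u != v -> adj H u v.

Definition hilbert_embeddable : Prop :=
  exists (E : hilbertSpace R) (phi : V -> E),
    forall u v, `|phi u - phi v| = graph_dist u v.

End Graph.

(* Main.v *)
(* If v has two non-adjacent neighbors a and b, they are at distance 2 and the
   parallelogram law makes phi v the midpoint of phi a and phi b; then v has no
   third neighbor c, since the law would also give d(a,c)^2 + d(b,c)^2 = 4, with
   both distances equal to 1 or 2.
   Hence, unless H is complete, connectedness spreads triangle-freeness from one
   vertex to all of them, every step of a walk repeats or reverses the previous
   one, and phi(V) lies in phi y + Z u for a unit vector u.  The resulting
   integer coordinate takes #|V| consecutive values because a geodesic between
   its two extremes has no repeated vertex.  Conversely a path embeds in R and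
   the complete graph on V embeds as the vectors e_v / sqrt 2. *)
Require Import Defs.
From HB Require Import structures.
From mathcomp Require Import all_boot all_order all_algebra.
From mathcomp Require Import all_classical all_reals all_analysis.
From mathcomp Require Import ring lra zify.

Set Implicit Arguments.
Unset Strict Implicit.
Unset Printing Implicit Defensive.

Import Order.TTheory GRing.Theory Num.Theory.
Import numFieldNormedType.Exports.

Local Open Scope classical_set_scope.
Local Open Scope ring_scope.

(** * Finite-dimensional Euclidean space as a Hilbert space *)

Definition euclidean (R : realType) (I : finType) := {ffun I -> R}.

Section Euclidean.
Variables (R : realType) (I : finType).
Local Notation E := (euclidean R I).
Implicit Types x y z : E.

HB.instance Definition _ := GRing.Lmodule.copy E {ffun I -> R}.

Definition eucl_dot x y : R := \sum_i x i * y i.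

Lemma eucl_dotC x y : eucl_dot x y = eucl_dot y x.
Proof. by apply: eq_bigr => i _; rewrite mulrC. Qed.

Lemma eucl_dotPl a x y z :
  eucl_dot (a *: x + y) z = a * eucl_dot x z + eucl_dot y z.
Proof.
rewrite /eucl_dot mulr_sumr -big_split; apply: eq_bigr => i _ /=.
by rewrite !ffunE -[_ *: _]/(a * x i) mulrDl mulrA.
Qed.

Lemma eucl_dotPr a x y z :
  eucl_dot z (a *: x + y) = a * eucl_dot z x + eucl_dot z y.
Proof. by rewrite !(eucl_dotC z) eucl_dotPl. Qed.

Lemma eucl_dot0 x : eucl_dot x 0 = 0.
Proof. by apply: big1 => i _; rewrite ffunE mulr0. Qed.

Lemma eucl_dot_ge0 x : 0 <= eucl_dot x x.
Proof. by apply: sumr_ge0 => i _; rewrite -expr2 sqr_ge0. Qed.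

Lemma sqr_le_eucl_dot x i : x i ^+ 2 <= eucl_dot x x.
Proof.
rewrite /eucl_dot (bigD1 i) //= expr2 lerDl.
by apply: sumr_ge0 => j _; rewrite -expr2 sqr_ge0.
Qed.

Lemma eucl_dot_eq0 x : eucl_dot x x = 0 -> x = 0.
Proof.
move=> x0; apply/ffunP => i; rewrite ffunE; apply/eqP.
by rewrite -sqrf_eq0 eq_le sqr_ge0 -x0 sqr_le_eucl_dot.
Qed.

Lemma eucl_dot_gt0 x : x != 0 -> 0 < eucl_dot x x.
Proof.
move=> xn0; rewrite lt_def eucl_dot_ge0 andbT.
by apply: contra xn0 => /eqP/eucl_dot_eq0 ->.
Qed.

Lemma eucl_cauchy_schwarz x y :
  eucl_dot x y ^+ 2 <= eucl_dot x x * eucl_dot y y.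
Proof.
have [->|yn0] := eqVneq y 0.
  by rewrite !eucl_dot0 expr0n mulr0.
have y_gt0 := eucl_dot_gt0 yn0.
(* The vector is the component of [x] orthogonal to [y]; its squared norm times [eucl_dot y y] is
   the Cauchy-Schwarz gap. *)
have := eucl_dot_ge0 (- (eucl_dot x y / eucl_dot y y) *: y + x).
rewrite eucl_dotPl !eucl_dotPr (eucl_dotC y x).
move: y_gt0; set a := eucl_dot x x; set b := eucl_dot y y; set c := eucl_dot x y.
move=> b_gt0 /(mulr_ge0 (ltW b_gt0)); rewrite -[in X in _ -> X]subr_ge0.
by congr (0 <= _); field; rewrite gt_eqF.
Qed.

Definition eucl_norm x : R := Num.sqrt (eucl_dot x x).

Lemma eucl_normD x y : eucl_norm (x + y) <= eucl_norm x + eucl_norm y.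
Proof.
rewrite -(@ler_pXn2r _ 2) ?nnegrE ?addr_ge0 ?sqrtr_ge0 //.
rewrite sqrrD !sqr_sqrtr ?eucl_dot_ge0 // -[x]scale1r eucl_dotPl !eucl_dotPr.
rewrite scale1r !mul1r (eucl_dotC y x).
suff : eucl_dot x y <= eucl_norm x * eucl_norm y by lra.
rewrite -sqrtrM ?eucl_dot_ge0 //; apply: le_trans (ler_norm _) _.
by rewrite -sqrtr_sqr ler_wsqrtr // eucl_cauchy_schwarz.
Qed.

Lemma eucl_normZ a x : eucl_norm (a *: x) = `|a| * eucl_norm x.
Proof.
rewrite /eucl_norm -[a *: x]addr0 eucl_dotPl eucl_dotPr.
rewrite (eucl_dotC 0) !eucl_dot0 !addr0 mulrA -expr2.
by rewrite sqrtrM ?sqr_ge0 // sqrtr_sqr.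
Qed.

Lemma eucl_norm_eq0 x : eucl_norm x = 0 -> x = 0.
Proof.
move/eqP; rewrite sqrtr_eq0 => x_le0; apply: eucl_dot_eq0.
by apply/le_anti; rewrite x_le0 eucl_dot_ge0.
Qed.

HB.instance Definition _ :=
  Lmodule_isNormed.Build R E eucl_normD eucl_normZ eucl_norm_eq0.

Lemma eucl_normE x : `|x| = Num.sqrt (eucl_dot x x).
Proof. by []. Qed.

Lemma coord_le_norm x i : `|x i| <= `|x|.
Proof. by rewrite eucl_normE -sqrtr_sqr ler_wsqrtr // sqr_le_eucl_dot. Qed.

Lemma norm_le_sum_coord x : `|x| <= \sum_i `|x i|.
Proof.
have s0 : 0 <= \sum_i `|x i| by apply: sumr_ge0.
rewrite -(@ler_pXn2r _ 2) ?nnegrE // eucl_normE sqr_sqrtr ?eucl_dot_ge0 //.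
rewrite expr2 mulr_sumr; apply: ler_sum => i _.
(* Termwise, one factor of [|x i| ^+ 2] is bounded by the full sum of the [|x j|]. *)
rewrite -expr2 -real_normK ?num_real // expr2 ler_wpM2r //.
by rewrite (bigD1 i) //= lerDl sumr_ge0.
Qed.

(** Coordinates are 1-Lipschitz, so each converges in [R]; as [I] is finite, the coordinatewise
    limits are approached simultaneously, and the l1 bound turns this into convergence in norm. *)
Lemma eucl_complete (F : set_system E) : ProperFilter F -> cauchy F -> cvg F.
Proof.
move=> FF /cauchy_ballP F_cauchy.
have cvF i : cvg ((fun x : E => x i : R) @ F).
  apply: cauchy_cvg; apply/cauchy_ballP => e e0.
  rewrite near_map2; apply: filterS (F_cauchy e e0).
  case=> x y /=; rewrite -!ball_normE /= => xy.
  apply: le_lt_trans xy; have := coord_le_norm (x - y) i.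
  by rewrite !ffunE.
apply/cvg_ex; exists ([ffun i => lim ((fun x : E => x i : R) @ F)] : E).
apply/cvgrPdist_lt => e e0.
(* The successor keeps the denominator nonzero when [I] is empty and makes the total of [#|I|]
   copies of [d] strictly less than [e]. *)
pose d : R := e / #|I|.+1%:R.
have d0 : 0 < d by rewrite divr_gt0.
have : \forall x \near F, forall i, `|lim ((fun y : E => y i : R) @ F) - (x : E) i| < d.
  by apply: filter_forall => i; have /cvgrPdist_lt := cvF i; apply.
apply: filterS => x xd; apply: le_lt_trans (norm_le_sum_coord _) _.
apply: (@le_lt_trans _ _ (\sum_(i : I) d)).
  by apply: ler_sum => i _; rewrite !ffunE ltW.
rewrite sumr_const -mulr_natr /d -mulrA gtr_pMr // mulrC.
by rewrite ltr_pdivrMr // mul1r ltr_nat.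
Qed.

HB.instance Definition _ := Uniform_isComplete.Build E eucl_complete.

Lemma eucl_dot_bilinear : bilinear_for
  (GRing.Scale.Law.clone R R *%R _)
  (GRing.Scale.Law.clone R R (@idfun R \; *%R) _) eucl_dot.
Proof. by split=> [z|z] a x y /=; [exact: eucl_dotPl|exact: eucl_dotPr]. Qed.

HB.instance Definition _ := bilinear_isBilinear.Build R E E R
  (GRing.Scale.Law.clone R R *%R _)
  (GRing.Scale.Law.clone R R (@idfun R \; *%R) _) eucl_dot eucl_dot_bilinear.

Lemma eucl_dot_hermitian x y :
  eucl_dot x y = (-1) ^+ false * @idfun R (eucl_dot y x).
Proof. by rewrite mul1r eucl_dotC. Qed.

HB.instance Definition _ :=
  isHermitianSesquilinear.Build R E false (@idfun R) eucl_dot eucl_dot_hermitian.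
HB.instance Definition _ := isDotProduct.Build R E eucl_dot eucl_dot_gt0.

Definition euclidean_hilbert : hilbertSpace R :=
  @HilbertSpace R E eucl_dot eucl_normE.

End Euclidean.

(** The classification of embeddable graphs draws on the inner product only through this law; the
    rest is normed-space geometry. *)
Lemma hilbert_parallelogram (R : realType) (E : hilbertSpace R) (x y : E) :
  `|x + y| ^+ 2 + `|x - y| ^+ 2 = 2 * (`|x| ^+ 2 + `|y| ^+ 2).
Proof.
pose f := @hilbert_dot R E.
have fE z : `|z| ^+ 2 = f z z.
  rewrite hilbert_normE sqr_sqrtr //; have [->|/neq0_dnorm_gt0/ltW//] := eqVneq z 0.
  by rewrite linear0r.
have fD : f (x + y) (x + y) = f x x + f x y + (f y x + f y y).
  by rewrite linearDl !linearDr.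
have fB : f (x - y) (x - y) = f x x - f x y - (f y x - f y y).
  by rewrite linearBl !linearBr.
by rewrite !fE fD fB; ring.
Qed.

(** * Shortest path distance under unit weights *)

Section UnitWeights.
Variables (R : realType) (V : finType) (H : weightedGraph R V).
Hypothesis H_conn : graph_connected H.
Hypothesis H_unit : forall u v : V, adj H u v -> weight H u v = 1.
Implicit Types (u v w a b : V) (p : seq V).

Lemma path_length_size u p :
  path (adj H) u p -> path_length H u p = (size p)%:R.
Proof.
rewrite /path_length; elim: p u => [|v p IH] u /=; first by rewrite big_nil.
by case/andP=> uv vp; rewrite big_cons IH // H_unit // -natr1 addrC.
Qed.

Lemma graph_dist_attained u v :
  exists2 p, path_from_to H u v p & graph_dist H u v = (size p)%:R.
Proof.
have [[p pP <-] _] := graph_distP u v H_conn.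
by exists p; rewrite // path_length_size //; case: pP.
Qed.

(** Here [p] may be a walk with repetitions: cutting out its loops leaves a simple path whose
    vertices all occur in [p], hence one that is no longer. *)
Lemma graph_dist_le_size u p :
  path (adj H) u p -> graph_dist H u (last u p) <= (size p)%:R.
Proof.
case/shortenP => q uq u_uniq /(uniq_leq_size _) q_le_p.
have [_ /(_ q) le_q] := graph_distP u (last u q) H_conn.
apply: le_trans (le_q _) _ => //; rewrite path_length_size // ler_nat q_le_p //.
by case/andP: u_uniq.
Qed.

Lemma graph_distxx u : graph_dist H u u = 0.
Proof.
apply/le_anti; rewrite (graph_dist_le_size (isT : path _ u [::])) /=.
by have [p _ ->] := graph_dist_attained u u.
Qed.

Lemma graph_dist0 u v : graph_dist H u v = 0 -> u = v.
Proof.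
have [[|a p] [_ _ /= <-] ->] // := graph_dist_attained u v.
by move/eqP; rewrite pnatr_eq0.
Qed.

Lemma graph_dist_eq1 u v : (graph_dist H u v == 1) = adj H u v.
Proof.
apply/eqP/idP => [|uv].
  have [p [up _ <-] ->] := graph_dist_attained u v.
  move/eqP; rewrite pnatr_eq1; case: p up => [|a [|b p]] //=.
  by rewrite andbT.
apply/le_anti; rewrite -{1}[v]/(last u [:: v]) (graph_dist_le_size (p := [:: v])) /=;
  last by rewrite uv.
have [[|a p] [_ _ E] ->] := graph_dist_attained u v; last by rewrite ler1n.
by move: uv; rewrite -E /= adj_irr.
Qed.

Lemma graph_dist_eq2 a v b :
  adj H v a -> adj H v b -> a != b -> ~~ adj H a b -> graph_dist H a b = 2.
Proof.
move=> va vb a_neq_b a_nadj_b.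
have : graph_dist H a b <= 2.
  by apply: (@graph_dist_le_size a [:: v; b]); rewrite /= adj_sym va vb.
have [p [ap _ pb] dE] := graph_dist_attained a b; rewrite dE ler_nat.
case: p ap pb dE => [|c [|d [|]]] //= ap pb _.
  by rewrite pb eqxx in a_neq_b.
by rewrite andbT pb (negPf a_nadj_b) in ap.
Qed.

Lemma graph_connected_ind (P : V -> Prop) u :
  P u -> (forall a v, adj H a v -> P a -> P v) -> forall v, P v.
Proof.
move=> Pu step v; have /connectP[p + ->] := H_conn u v.
by elim: p u Pu => //= a p IH u Pu /andP[/step/(_ Pu)]; exact: IH.
Qed.

(** The hypothesis makes adjacency transitive between distinct vertices, so being equal or adjacent
    to [u] spreads along walks. *)
Lemma complete_of_adjacent_neighbors :
  (forall v a b, adj H v a -> adj H v b -> a != b -> adj H a b) ->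
  is_complete_graph H.
Proof.
move=> nbr u; apply: (@graph_connected_ind _ u); first by rewrite eqxx.
move=> a v av IH uv; have [ua|/IH ua] := eqVneq u a; first by rewrite ua.
by apply: nbr av uv; rewrite adj_sym.
Qed.

(** * Geometry of an embedded graph *)

Section FromEmbedding.
Variables (E : hilbertSpace R) (phi : V -> E).
Hypothesis phiE : forall u v, `|phi u - phi v| = graph_dist H u v.

Let phi_adj v a : adj H v a -> `|phi a - phi v| = 1.
Proof. by move=> va; apply/eqP; rewrite phiE graph_dist_eq1 adj_sym. Qed.

(** The two difference vectors are unit vectors at distance 2, so the parallelogram law leaves 2(1 +
    1) - 4 = 0 for the squared norm of their sum. *)
Lemma embedding_midpoint v a b : adj H v a -> adj H v b -> a != b ->
  ~~ adj H a b -> phi b - phi v = - (phi a - phi v).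
Proof.
move=> va vb ab nab; apply/eqP; rewrite -addr_eq0 -normr_eq0 addrC -sqrf_eq0.
have := hilbert_parallelogram (phi a - phi v) (phi b - phi v).
rewrite !phi_adj // [X in _ + `|X| ^+ 2](_ : _ = phi a - phi b); last first.
  by rewrite opprB addrA subrK.
by rewrite phiE (graph_dist_eq2 va vb) // => h; apply/eqP; lra.
Qed.

Lemma embedding_two_neighbors v a b c : adj H v a -> adj H v b -> a != b ->
  ~~ adj H a b -> adj H v c -> (c == a) || (c == b).
Proof.
move=> va vb ab nab vc.
have := hilbert_parallelogram (phi a - phi v) (phi c - phi v).
rewrite !phi_adj // [X in _ + `|X| ^+ 2](_ : _ = phi a - phi c); last first.
  by rewrite opprB addrA subrK.
(* Since [v] sits at the midpoint, [phi a - phi v] is [phi v - phi b], which turns the sum into a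
   difference of embedded vertices. *)
rewrite [X in `|X| ^+ 2](_ : _ = phi c - phi b); last first.
  by rewrite addrC -[phi a - _]opprK -(embedding_midpoint va vb) // opprB addrA subrK.
have [//|ca] := eqVneq c a; have [//|cb /=] := eqVneq c b.
have dist12 w : adj H v w -> c != w ->
    graph_dist H c w = 1 \/ graph_dist H c w = 2.
  move=> vw cw; have [|ncw] := boolP (adj H c w).
    by rewrite -graph_dist_eq1 => /eqP ->; left.
  by right; exact: graph_dist_eq2 vc vw cw ncw.
(* The two squared distances are each 1 or 4, so their sum is 2, 5 or 8, whereas the law demands
   4. *)
rewrite (distrC (phi a)) !phiE.
by case: (dist12 a va ca) => ->; case: (dist12 b vb cb) => ->; lra.
Qed.

Lemma triangle_free_vertex v a b : adj H v a -> adj H v b -> a != b ->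
  ~~ adj H a b -> forall c d, adj H v c -> adj H v d -> ~~ adj H c d.
Proof.
move=> va vb ab nab c d vc vd.
case/orP: (embedding_two_neighbors va vb ab nab vc) => /eqP ->;
case/orP: (embedding_two_neighbors va vb ab nab vd) => /eqP ->;
by rewrite ?adj_irr // adj_sym.
Qed.

Lemma triangle_free_graph v a b : adj H v a -> adj H v b -> a != b ->
  ~~ adj H a b -> forall w c d, adj H w c -> adj H w d -> ~~ adj H c d.
Proof.
move=> va vb ab nab; apply: (@graph_connected_ind _ v).
  exact: triangle_free_vertex va vb ab nab.
move=> u w uw free_u c d wc wd; apply/negP => cd.
(* Suppose [w], [c], [d] form a triangle. If [c] is [u], then [w] and [d] are adjacent neighbors of
   [u]. Otherwise [c] is not adjacent to [u], as [w] and [c] would be such neighbors; so [u] and [c]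
   form a gap at [w], which rules out the edge [c d]. *)
have [cu|cu] := eqVneq c u.
  by have := free_u w d uw; rewrite wd -cu cd => /(_ isT).
have uc : ~~ adj H u c by apply/negP => /(free_u _ _ uw); rewrite wc.
have wu : adj H w u by rewrite adj_sym.
rewrite eq_sym in cu.
by have := triangle_free_vertex wu wc cu uc wc wd; rewrite cd.
Qed.

Lemma embedding_on_line y x : adj H y x ->
  (forall w c d, adj H w c -> adj H w d -> ~~ adj H c d) ->
  forall v, exists k : int, phi v = phi y + k%:~R *: (phi x - phi y).
Proof.
move=> yx free; set u := phi x - phi y.
have xE : phi x = phi y + u by rewrite addrC subrK.
clearbody u.
have reflect w a b : adj H w a -> adj H w b -> a != b ->
    phi b = phi w - (phi a - phi w).
  move=> wa wb ab; rewrite -(embedding_midpoint wa wb ab (free _ _ _ wa wb)).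
  by rewrite addrC subrK.
(* The induction also carries the position of every neighbor, since the step from [a] to [v] needs
   to know that it is [u] or [- u]. *)
suff line_step v : (exists k : int, phi v = phi y + k%:~R *: u) /\
    forall w, adj H v w -> phi w = phi v + u \/ phi w = phi v - u.
  by move=> v; case: (line_step v).
move: v; apply: (@graph_connected_ind _ y) => [|a v av [[k ak] nbr_a]].
  split; first by exists 0; rewrite scale0r addr0.
  move=> w yw; have [<-|xw] := eqVneq x w; first by left.
  by right; rewrite (reflect y x) // xE [phi y + u]addrC addrK.
split.
  case: (nbr_a v av) => ->; rewrite ak.
    by exists (k + 1); rewrite intrD scalerDl scale1r addrA.
  by exists (k - 1); rewrite intrB scalerBl scale1r addrA.
have va : adj H v a by rewrite adj_sym.
(* The predecessor [a] lies one step back; any other neighbor is its reflection through [phi v],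
   hence one step forward. *)
move=> w vw; have [<-|aw] := eqVneq a w.
  case: (nbr_a v av) => ->; first by right; rewrite addrK.
  by left; rewrite subrK.
rewrite (reflect v a w va vw aw).
case: (nbr_a v av) => ->; rewrite opprB [X in _ + X]addrAC subrr.
  by left; rewrite add0r.
by right; rewrite add0r.
Qed.

Lemma embedding_int_coordinate y x : adj H y x ->
  (forall w c d, adj H w c -> adj H w d -> ~~ adj H c d) ->
  exists f : V -> int, forall u v, graph_dist H u v = `|f u - f v|%:~R.
Proof.
move=> yx free; have /choice[f fE] := embedding_on_line yx free.
exists f => u v.
have -> : graph_dist H u v = `|((f u)%:~R - (f v)%:~R) *: (phi x - phi y)|.
  by rewrite -phiE (fE u) (fE v) opprD addrACA subrr add0r scalerBl.
by rewrite normrZ phi_adj // mulr1 -intrB intr_norm.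
Qed.

End FromEmbedding.

(** * From an integer coordinate to a path graph *)

Lemma path_graph_of_int_coordinate (f : V -> int) (y : V) :
  (forall u v, graph_dist H u v = `|f u - f v|%:~R) -> is_path_graph H.
Proof.
move=> fE.
(* The vertex [y] makes [V] inhabited, so that [f] has extremes. *)
have [m _ f_ge] := Order.TotalTheory.arg_minP f (isT : xpredT y).
have [M _ f_le] := Order.TotalTheory.arg_maxP f (isT : xpredT y).
(* A geodesic from [M] to [m] visits [|f M - f m| + 1] distinct vertices. *)
have range : (`|f M - f m| < #|V|)%N.
  have [p [_ up _]] := graph_dist_attained M m; rewrite fE.
  move/eqP; rewrite -[(size p)%:R]/((size p : int)%:~R) eqr_int => /eqP sz.
  have := max_card (mem (M :: p)); rewrite (card_uniqP up) /=; lia.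
have g_lt v : (`|f v - f m| < #|V|)%N.
  by have := f_ge v isT; have := f_le v isT; move: range; lia.
(* Shifted to start at 0, the coordinate is an injection between sets of equal cardinality; its
   inverse numbers the path. *)
pose g v : 'I_#|V| := Ordinal (g_lt v).
have gE v : (g v : int) = f v - f m by have := f_ge v isT; rewrite /=; lia.
have g_inj : injective g.
  move=> u v uv; apply: graph_dist0; rewrite fE.
  by have := gE u; rewrite uv gE => ?; rewrite (_ : f u - f v = 0) //; lia.
have g_bij : bijective g by apply: inj_card_bij; rewrite ?card_ord.
have [h gK hK] := g_bij.
exists #|V|, h; split; first by exists g.
move=> i j; rewrite -{2}(hK i) -{2}(hK j) !gE -graph_dist_eq1 fE.
rewrite opprB addrA subrK -[1 : R]/(1%:~R) eqr_int.
by split=> [/eqP|->].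
Qed.

(** * Embeddings of path graphs and complete graphs *)

Lemma path_graph_dist n (v : 'I_n -> V) :
  bijective v ->
  (forall i j : 'I_n, adj H (v i) (v j) <-> `|i%:Z - j%:Z| = 1) ->
  forall i j, graph_dist H (v i) (v j) = `|i%:Z - j%:Z|%:~R.
Proof.
move=> [g gK hK] adjE i j; apply/le_anti/andP; split.
  (* Upper bound: walk from [i'] to [j], moving the index one unit closer at each step. *)
  have walk k (i' : 'I_n) : `|i'%:Z - j%:Z| = k%:Z ->
      exists p, [/\ path (adj H) (v i') p, last (v i') p = v j & size p = k].
    elim: k i' => [|k IH] i' i'j.
      by exists [::]; split=> //=; congr v; apply: val_inj => /=; lia.
    have [i2 i2i i2j] : exists2 i2 : 'I_n,
        `|i'%:Z - i2%:Z| = 1 & `|i2%:Z - j%:Z| = k%:Z.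
      have i'_lt := ltn_ord i'; have j_lt := ltn_ord j.
      case: (ltnP i' j) => ij.
        have i2_lt : (i'.+1 < n)%N by lia.
        by exists (Ordinal i2_lt) => /=; lia.
      have i2_lt : (i'.-1 < n)%N by lia.
      by exists (Ordinal i2_lt) => /=; lia.
    have [p [p_path pj sz]] := IH i2 i2j.
    exists (v i2 :: p); split=> //=; last by rewrite sz.
    by rewrite p_path andbT; apply/adjE.
  have ij : `|i%:Z - j%:Z| = `|i%:Z - j%:Z|%N by lia.
  have [p [p_path pj sz]] := walk _ _ ij.
  by rewrite -pj ij -sz; exact: graph_dist_le_size.
(* Lower bound: each edge changes the index by exactly 1, so a path cannot be shorter than the index
   gap. *)
have [p [p_path _ pj] ->] := graph_dist_attained (v i) (v j).
rewrite -[(size p)%:R]/((size p : int)%:~R) ler_int.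
have -> : j = g (last (v i) p) by rewrite pj gK.
elim: p i p_path {pj} => [|b p IH] i /=; first by rewrite gK subrr.
case/andP; rewrite -(hK b) => /adjE ib /IH.
by move: ib; rewrite !hK /=; lia.
Qed.

Lemma path_graph_embeddable : is_path_graph H -> hilbert_embeddable H.
Proof.
case=> n [v [v_bij adjE]]; have distE := path_graph_dist v_bij adjE.
have [g gK hK] := v_bij.
exists (euclidean_hilbert R 'I_1).
exists (fun u => [ffun=> (g u)%:R] : euclidean R 'I_1) => a b.
rewrite [LHS]eucl_normE /eucl_dot big_ord1 !ffunE -expr2 sqrtr_sqr.
by rewrite -(hK a) -(hK b) distE !hK intr_norm intrB.
Qed.

Lemma complete_graph_embeddable : is_complete_graph H -> hilbert_embeddable H.
Proof.
move=> complete; exists (euclidean_hilbert R V).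
(* Images of distinct vertices differ in exactly two coordinates, each contributing 1/2 to the
   squared distance. *)
exists (fun u => [ffun w => (u == w)%:R / Num.sqrt 2] : euclidean R V) => a b.
have [<-|ab] := eqVneq a b; first by rewrite subrr normr0 graph_distxx.
rewrite (eqP (_ : graph_dist H a b == 1)); last by rewrite graph_dist_eq1 complete.
rewrite [LHS]eucl_normE /eucl_dot (bigD1 a) // (bigD1 b) /=; last by rewrite eq_sym.
rewrite big1 => [|c /andP[ca cb]]; last first.
  by rewrite !ffunE ![_ == c]eq_sym (negPf ca) (negPf cb); ring.
rewrite !ffunE !eqxx (negPf ab) eq_sym (negPf ab) -!expr2 addr0.
rewrite mul0r sub0r subr0 sqrrN mul1r exprVn sqr_sqrtr //.
by rewrite (_ : _ + _ = 1) ?sqrtr1 //; field.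
Qed.

Lemma embeddable_path_or_complete :
  hilbert_embeddable H -> is_path_graph H \/ is_complete_graph H.
Proof.
case=> E [phi phiE].
have [[v [a [b [va vb ab nab]]]]|no_gap] :=
    pselect (exists v a b, [/\ adj H v a, adj H v b, a != b & ~~ adj H a b]).
  left; have free := triangle_free_graph phiE va vb ab nab.
  have [f fE] := embedding_int_coordinate phiE va free.
  exact: path_graph_of_int_coordinate v fE.
right; apply: complete_of_adjacent_neighbors => v a b va vb ab.
by apply/negPn/negP => nab; apply: no_gap; exists v, a, b.
Qed.

End UnitWeights.

Theorem theorem1 (R : realType) (V : finType) (H : weightedGraph R V)
    (H_conn : graph_connected H)
    (H_unit : forall u v : V, adj H u v -> weight H u v = 1) :
  hilbert_embeddable H <-> is_path_graph H \/ is_complete_graph H.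
Proof.
split; first exact: embeddable_path_or_complete.
by case; [exact: path_graph_embeddable|exact: complete_graph_embeddable].
Qed.
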